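(* Let $n\ge 1$ be an integer. For every $d\in\mathbb{Z}\setminus\{0\}$ one has $R^d\circ T_d = T_d\circ R$ as maps $\mathbb{C}^n\to\mathbb{C}^n$, where $T_d$ is the Chebyshev endomorphism of $\mathbb{C}^n$ of degree $d$ (type $A_n$) and $R(z_1,\dots,z_n)=(\zeta z_1,\zeta^2 z_2,\dots,\zeta^n z_n)$ with $\zeta=e^{2\pi i/(n+1)}$.
   Context: For $t_1,\dots,t_{n+1}\in\mathbb{C}^*$ with $t_1t_2\cdots t_{n+1}=1$ put $\Phi(t_1,\dots,t_{n+1})=(z_1,\dots,z_n)$, where $z_j$ is the $j$-th elementary symmetric polynomial in $t_1,\dots,t_{n+1}$. Every point of $\mathbb{C}^n$ is of this form for a multiset $\{t_1,\dots,t_{n+1}\}$, unique as a multiset. For $d\in\mathbb{Z}\setminus\{0\}$ the Chebyshev endomorphism $T_d=P_{A_n}^d:\mathbb{C}^n\to\mathbb{C}^n$ is the (well-defined, polynomial) map determined by $T_d(\Phi(t_1,\dots,t_{n+1}))=\Phi(t_1^d,\dots,t_{n+1}^d)$. $R^d$ denotes the $d$-th power of the invertible linear map $R$ under composition. *)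

(* Defs.v *)
From HB Require Import structures.
From mathcomp Require Import all_boot all_order all_algebra.
From mathcomp Require Import complex.
From mathcomp Require Import reals trigo.
(* Not imported: the notations of mpoly clash with those of analysis. *)
From mathcomp Require mpoly.

Set Implicit Arguments.
Unset Strict Implicit.
Unset Printing Implicit Defensive.

Import GRing.Theory Num.Theory.
Local Open Scope ring_scope.
Local Open Scope complex_scope.

(* The entry of index j : 'I_n, counted from 0, is z_{j+1}. *)
Definition Phi (F : fieldType) (n : nat) (t : n.+1.-tuple F) : 'rV[F]_n :=
  \row_(j < n) mpoly.meval (tnth t) (mpoly.mesym n.+1 F j.+1).

Section PhiTheory.
Variables (F : closedFieldType) (n : nat).
Implicit Types (t u : n.+1.-tuple F) (z : 'rV[F]_n).

Lemma mesym_perm k t u : perm_eq t u ->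
  mpoly.meval (tnth t) (mpoly.mesym n.+1 F k) =
  mpoly.meval (tnth u) (mpoly.mesym n.+1 F k).
Proof.
move=> tu; have [kn|nk] := leqP k n.+1; last first.
  by rewrite mpoly.mesym_geqnE // !mpoly.meval0.
have Et := mpoly.mroots_coeff t (Ordinal (kn : (k < n.+2)%N)).
have Eu := mpoly.mroots_coeff u (Ordinal (kn : (k < n.+2)%N)).
rewrite (perm_big _ tu) /= Eu /= in Et.
by move/(mulfI (negbT (signr_eq0 F k))): Et.
Qed.

Lemma Phi_perm t u : perm_eq t u -> Phi t = Phi u.
Proof. by move=> tu; apply/rowP => j; rewrite !mxE; apply: mesym_perm. Qed.

Lemma mesym_prod t :
  mpoly.meval (tnth t) (mpoly.mesym n.+1 F n.+1) = \prod_(x <- t) x.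
Proof.
rewrite mpoly.mesymnnE big_tuple.
rewrite (big_morph _ (mpoly.mevalM (tnth t)) (mpoly.meval1 (tnth t))).
by apply: eq_bigr => i _; rewrite mpoly.mevalXU.
Qed.

Lemma Phi_inj t u : \prod_(x <- t) x = 1 -> \prod_(x <- u) x = 1 ->
  Phi t = Phi u -> perm_eq t u.
Proof.
move=> t1 u1 tu; apply: prod_XsubC_eq; apply/polyP => i.
have [ni|] := ltnP n.+1 i.
  by rewrite !nth_default // size_prod_XsubC size_tuple.
rewrite -ltnS => ni; pose k := rev_ord (Ordinal ni).
have -> : i = (n.+1 - k)%N by rewrite /= subSS subKn.
rewrite !mpoly.mroots_coeff; congr (_ * _).
case: k => -[|k] /= kn; first by rewrite !mpoly.mesym0E !mpoly.meval1.
have [kn'|] := ltnP k n; last first.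
  move=> nk; have -> : k = n by apply/eqP; rewrite eqn_leq nk andbT.
  by rewrite !mesym_prod t1 u1.
by have /rowP/(_ (Ordinal kn')) := tu; rewrite !mxE.
Qed.

Lemma Phi_surj z : exists t, (\prod_(x <- t) x == 1) && (Phi t == z).
Proof.
pose c k : F := if k is k'.+1 then
  if insub k' is Some j then z 0 j else 1 else 1.
pose p : {poly F} := \poly_(i < n.+2) ((-1) ^+ (n.+1 - i) * c (n.+1 - i)%N).
have pn1 : p`_n.+1 = 1 by rewrite coef_poly ltnSn subnn mul1r.
have sp : size p = n.+2.
  apply/eqP; rewrite eqn_leq size_poly /=.
  by apply: contraT; rewrite -leqNgt => /(nth_default 0) /eqP;
    rewrite pn1 oner_eq0.
have lp : lead_coef p = 1 by rewrite lead_coefE sp.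
have [r] := closed_field_poly_normal p; rewrite lp scale1r => pr.
have sr : size r == n.+1 by move: sp; rewrite pr size_prod_XsubC => -[->].
exists (Tuple sr).
have E k : (k < n.+2)%N ->
    mpoly.meval (tnth (Tuple sr)) (mpoly.mesym n.+1 F k) = c k.
  move=> kn; have := mpoly.mroots_coeff (Tuple sr) (Ordinal kn).
  rewrite /= -pr coef_poly ltnS leq_subr subKn //.
  by move/(mulfI (negbT (signr_eq0 F k))).
rewrite -mesym_prod E // /c insubF ?ltnn // eqxx /=.
apply/eqP/rowP => j; rewrite mxE E ?ltnS 1?ltnW //=.
by rewrite /c insubT //= => jn; congr (z 0 _); apply: val_inj.
Qed.

(* One ordering of the multiset above z; see Phi_inj for its uniqueness. *)
Definition Phi_fiber z : n.+1.-tuple F := xchoose (Phi_surj z).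

Lemma Phi_fiber_prod z : \prod_(x <- Phi_fiber z) x = 1.
Proof. by have /andP[/eqP] := xchooseP (Phi_surj z). Qed.

Lemma Phi_fiberK z : Phi (Phi_fiber z) = z.
Proof. by have /andP[_ /eqP] := xchooseP (Phi_surj z). Qed.

Definition chebyshev (d : int) z : 'rV[F]_n :=
  Phi (map_tuple (fun x => x ^ d) (Phi_fiber z)).

Lemma chebyshev_Phi (d : int) t : \prod_(x <- t) x = 1 ->
  chebyshev d (Phi t) = Phi (map_tuple (fun x => x ^ d) t).
Proof.
move=> t1; apply: Phi_perm; apply: perm_map.
by apply: Phi_inj; rewrite ?Phi_fiberK ?Phi_fiber_prod.
Qed.

End PhiTheory.

(* chebyshev d is the only map satisfying chebyshev_Phi. *)
Lemma chebyshev_unique (F : closedFieldType) (n : nat) (d : int)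
    (T : 'rV[F]_n -> 'rV[F]_n) :
  (forall t : n.+1.-tuple F, \prod_(x <- t) x = 1 ->
     T (Phi t) = Phi (map_tuple (fun x => x ^ d) t)) ->
  T =1 chebyshev d.
Proof.
by move=> HT z; rewrite -{1}(Phi_fiberK z) HT // Phi_fiber_prod.
Qed.

(* Meaningful when lker f = 0, in which case f^-1 is the two-sided inverse. *)
Definition lfun_expz (K : fieldType) (V : vectType K) (f : 'End(V)) (d : int) :
    'End(V) :=
  match d with
  | Posz k => iter k (comp_lfun f) \1%VF
  | Negz k => iter k.+1 (comp_lfun f^-1%VF) \1%VF
  end.

Lemma lfun_expz_pos (K : fieldType) (V : vectType K) (f : 'End(V)) (k : nat) :
  lfun_expz f k =1 iter k f.
Proof.
by move=> u; elim: k => [|k IHk] /=; rewrite lfunE //= -IHk.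
Qed.

Lemma lfun_expz_negK (K : fieldType) (V : vectType K) (f : 'End(V)) (k : nat) :
  lker f == 0%VS -> cancel (iter k f) (lfun_expz f (- k%:Z)).
Proof.
move=> f0; case: k => [|k] u; first exact: id_lfunE.
rewrite /lfun_expz -NegzE; set g := iter k.+1 _ _.
have -> : g (iter k.+1 f u) = iter k.+1 f^-1%VF (iter k.+1 f u).
  rewrite {}/g; move: (iter k.+1 f u) => v.
  by elim: k.+1 => [|j IHj] /=; rewrite lfunE //= IHj.
by elim: k.+1 => // j IHj; rewrite iterSr iterS lker0_lfunK.
Qed.

Definition zeta (R : realType) (n : nat) : R[i] :=
  let theta := 2 * pi / n.+1%:R in cos theta +i* sin theta.

Section ZetaRot.
Variables (R : realType) (n : nat).

Definition zeta_rot_fun (z : 'rV[R[i]]_n) : 'rV[R[i]]_n :=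
  \row_(j < n) (zeta R n ^+ j.+1 * z 0 j).

Lemma zeta_rot_fun_is_linear : linear zeta_rot_fun.
Proof. by move=> a u v; apply/rowP => j; rewrite !mxE mulrDr mulrCA. Qed.

HB.instance Definition _ := GRing.isLinear.Build R[i] 'rV[R[i]]_n 'rV[R[i]]_n
  *:%R zeta_rot_fun zeta_rot_fun_is_linear.

Definition zeta_rot : 'End('rV[R[i]]_n) := linfun zeta_rot_fun.

Lemma zeta_rotE z j : zeta_rot z 0 j = zeta R n ^+ j.+1 * z 0 j.
Proof. by rewrite lfunE mxE. Qed.

Lemma zeta_neq0 : zeta R n != 0.
Proof.
rewrite /zeta eq_complex /= negb_and; apply/orP.
set x := 2 * pi / _; have [c0|] := eqVneq (cos x) 0; [right | by left].
by have := cos2Dsin2 x; rewrite c0 expr0n add0r;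
  apply: contra_eq_neq => ->; rewrite expr0n eq_sym oner_eq0.
Qed.

(* Hence zeta_rot^-1 is a two-sided inverse: lker0_lfunK, lker0_lfunVK. *)
Lemma lker_zeta_rot : lker zeta_rot == 0%VS.
Proof.
apply/lker0P => u v /rowP uv; apply/rowP => j.
by have := uv j; rewrite !zeta_rotE => /(mulfI (expf_neq0 _ zeta_neq0)).
Qed.

End ZetaRot.

(* Main.v *)
(* Elementary symmetric polynomials are homogeneous, so R lifts along Phi to
   t |-> (zeta t_1, .., zeta t_(n+1)), which preserves the condition
   \prod t_i = 1 because zeta^(n+1) = 1. Both sides then send Phi t to the
   image under Phi of (zeta^d t_1^d, .., zeta^d t_(n+1)^d). *)
Require Import Defs.
From mathcomp Require Import all_boot all_order all_algebra.
From mathcomp Require Import complex reals trigo.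
From mathcomp Require mpoly.

Set Implicit Arguments.
Unset Strict Implicit.
Unset Printing Implicit Defensive.

Import GRing.Theory Num.Theory.
Local Open Scope ring_scope.

(** Each monomial is a product over a set [h] of [k] indices, so it picks up one factor [c] per
    element of [h]. *)
Lemma meval_mesym_scale (F : fieldType) (m k : nat) (c : F) (t : m.-tuple F) :
  mpoly.meval (tnth (map_tuple ( *%R c) t)) (mpoly.mesym m F k) =
  c ^+ k * mpoly.meval (tnth t) (mpoly.mesym m F k).
Proof.
rewrite !(big_morph _ (mpoly.mevalD _) (mpoly.meval0 _)) mulr_sumr.
apply: eq_bigr => h /eqP <-.
rewrite !(big_morph _ (mpoly.mevalM _) (mpoly.meval1 _)).
rewrite -prodr_const -big_split /=.
by apply: eq_bigr => i _; rewrite !mpoly.mevalXU tnth_map.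
Qed.

Lemma Phi_scale (F : fieldType) (n : nat) (c : F) (t : n.+1.-tuple F) :
  Phi (map_tuple ( *%R c) t) = \row_(j < n) (c ^+ j.+1 * Phi t 0 j).
Proof. by apply/rowP => j; rewrite !mxE meval_mesym_scale. Qed.

Lemma complex_moivre (R : realType) (x : R) (k : nat) :
  (cos x +i* sin x)%C ^+ k = (cos (x *+ k) +i* sin (x *+ k))%C.
Proof.
elim: k => [|k IHk]; first by rewrite expr0 mulr0n cos0 sin0.
rewrite exprS IHk mulrS cosD sinD.
by congr (_ +i* _)%C; rewrite addrC.
Qed.

Lemma zeta_unity (R : realType) (n : nat) : zeta R n ^+ n.+1 = 1.
Proof.
rewrite /zeta complex_moivre -[_ *+ n.+1]mulr_natr divfK ?pnatr_eq0 //.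
by rewrite mulr_natl cos2pi sin2pi.
Qed.

(** The inverse is given abstractly; its coordinates are read off by applying [zeta_rot] to it and
    dividing by the nonzero power of [zeta]. *)
Lemma zeta_rotVE (R : realType) (n : nat) (z : 'rV[R[i]]_n) (j : 'I_n) :
  (zeta_rot R n)^-1%VF z 0 j = (zeta R n)^-1 ^+ j.+1 * z 0 j.
Proof.
have /rowP/(_ j) := lker0_lfunVK (lker_zeta_rot R n) z.
rewrite zeta_rotE => <-.
by rewrite exprVn mulKf // expf_neq0 // zeta_neq0.
Qed.

Lemma zeta_rot_expzE (R : realType) (n : nat) (d : int) (z : 'rV[R[i]]_n)
    (j : 'I_n) :
  lfun_expz (zeta_rot R n) d z 0 j = (zeta R n ^ d) ^+ j.+1 * z 0 j.
Proof.
case: d => k; rewrite /lfun_expz.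
  elim: k => [|k IHk]; first by rewrite id_lfunE expr1n mul1r.
  by rewrite iterS comp_lfunE zeta_rotE IHk mulrA -exprMn -exprSz.
(* [Negz k] stands for -(k+1): the power becomes a natural power of the inverse of [zeta], and the
   previous induction carries over. *)
rewrite NegzE -exprz_inv.
elim: k.+1 => [|m IHm]; first by rewrite id_lfunE expr1n mul1r.
by rewrite iterS comp_lfunE zeta_rotVE IHm mulrA -exprMn -exprSz.
Qed.

Theorem proposition2p1 (R : realType) (n : nat) (d : int) :
  (1 <= n)%N -> d != 0 ->
  lfun_expz (zeta_rot R n) d \o chebyshev d
    =1 chebyshev d \o zeta_rot R n.
Proof.
move=> _ _ z /=; rewrite -(Phi_fiberK z).
(* Of the chosen fibre only the product condition is kept, which is what [chebyshev_Phi]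
   requires. *)
have := Phi_fiber_prod z; move: (Phi_fiber z) => t t1.
have -> : zeta_rot R n (Phi t) = Phi (map_tuple ( *%R (zeta R n)) t).
  by apply/rowP => j; rewrite zeta_rotE Phi_scale [RHS]mxE.
rewrite !chebyshev_Phi //; last first.
  (* The scaled tuple has product [zeta R n ^+ n.+1], which is 1. *)
  rewrite big_map big_split /= t1 mulr1 big_tuple.
  by rewrite prodr_const card_ord zeta_unity.
have -> : map_tuple (fun x => x ^ d) (map_tuple ( *%R (zeta R n)) t) =
    map_tuple ( *%R (zeta R n ^ d)) (map_tuple (fun x => x ^ d) t).
  by apply: eq_from_tnth => i; rewrite !tnth_map expfzMl.
by rewrite Phi_scale; apply/rowP => j; rewrite zeta_rot_expzE [RHS]mxE.
Qed.
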